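(* Let $p,q$ be primes with $p<q$ such that a non-abelian group of order $pq$ exists, and let $G_{pq}$ denote this (unique up to isomorphism) non-abelian group of order $pq$. Then the characteristic polynomial of the distance matrix of the enhanced power graph $\mathcal{G}_E(G_{pq})$ is \[ \phi_D(\mathcal{G}_E(G_{pq}),x) = (x+1)^{pq-q-2} (x+p)^{q-1} \Big[x^3+x^2(-2pq+p+q+2)+ x(-2pq^2-2pq+2q^2+2p+1) -(pq^2+pq-p-q^2)\Big]. \]
   Context: For a group $G$, the enhanced power graph $\mathcal{G}_E(G)$ is the simple graph with vertex set $G$ in which distinct $a,b$ are adjacent if and only if $a,b\in\langle c\rangle$ for some $c\in G$. The distance matrix $D(\Gamma)$ of a connected graph $\Gamma$ has $(u,v)$-entry equal to the graph distance $d(u,v)$ (and $0$ on the diagonal). For a matrix $B$, $\phi(B,x)=\det(xI-B)$, and $\phi_D(\Gamma,x)$ denotes the characteristic polynomial of the distance matrix of $\Gamma$. *)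

(* Defs.v *)
From HB Require Import structures.
From mathcomp Require Import all_boot all_order all_algebra all_fingroup.

Set Implicit Arguments.
Unset Strict Implicit.
Unset Printing Implicit Defensive.

Import GRing.Theory Num.Theory.
Local Open Scope ring_scope.

Section GraphDistance.
Variables (T : finType) (e : rel T).

Definition has_walk (k : nat) (u v : T) : bool :=
  [exists w : k.-tuple T, path e u w && (last u w == v)].

(* Searching lengths below #|T| loses nothing: see gdist_walk and gdist_le.
   Vertices in different components get the junk value #|T|. *)
Definition gdist (u v : T) : nat :=
  find (fun k => has_walk k u v) (iota 0 #|T|).

Lemma has_walkP k u v :
  reflect (exists w : seq T, [/\ path e u w, last u w = v & size w = k])
          (has_walk k u v).
Proof.
apply: (iffP existsP) => [[w /andP[pw /eqP lw]]|[w [pw lw sw]]].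
  by exists w; rewrite size_tuple.
have sw' : size w == k by apply/eqP.
by exists (Tuple sw'); rewrite /= pw lw eqxx.
Qed.

Lemma has_gdist_walk u v : connect e u v ->
  has (fun k => has_walk k u v) (iota 0 #|T|).
Proof.
case/connectP => w pw lw; case/shortenP: pw lw => w' pw' uw' _ lw.
apply/hasP; exists (size w').
  rewrite mem_iota add0n /=.
  by have := max_card (mem (u :: w')); rewrite (card_uniqP uw').
by apply/has_walkP; exists w'.
Qed.

Lemma gdist_walk u v : connect e u v -> has_walk (gdist u v) u v.
Proof.
move=> /has_gdist_walk h; have := nth_find 0%N h.
by rewrite nth_iota ?add0n // -[X in (_ < X)%N](size_iota 0) -has_find.
Qed.

Lemma gdist_le u v k : has_walk k u v -> (gdist u v <= k)%N.
Proof.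
move=> hk; rewrite leqNgt; apply/negP => ltk.
have := before_find 0%N ltk; rewrite nth_iota ?add0n ?hk //.
by apply: leq_trans ltk _; rewrite -[X in (_ <= X)%N](size_iota 0) find_size.
Qed.

(* Rows and columns follow the enumeration of T; the characteristic polynomial
   does not depend on that choice. *)
Definition distance_matrix : 'M[int]_#|T| :=
  \matrix_(i, j) (gdist (enum_val i) (enum_val j))%:Z.

Definition distance_char_poly : {poly int} := char_poly distance_matrix.

End GraphDistance.

Definition enhanced_power_graph (gT : finGroupType) : rel gT :=
  fun a b => (a != b) && [exists c : gT, (a \in <[c]>%g) && (b \in <[c]>%g)].

Lemma enhanced_power_graph_sym (gT : finGroupType) :
  symmetric (@enhanced_power_graph gT).
Proof.
move=> a b; rewrite /enhanced_power_graph eq_sym; congr (_ && _).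
by apply: eq_existsb => c; rewrite andbC.
Qed.

Lemma enhanced_power_graph_irr (gT : finGroupType) :
  irreflexive (@enhanced_power_graph gT).
Proof. by move=> a; rewrite /enhanced_power_graph eqxx. Qed.

Lemma enhanced_power_graph_connected (gT : finGroupType) (a b : gT) :
  connect (@enhanced_power_graph gT) a b.
Proof.
have to1 c : connect (@enhanced_power_graph gT) c 1%g.
  have [-> //|c1] := eqVneq c 1%g; apply: connect1.
  by rewrite /enhanced_power_graph c1; apply/existsP; exists c; rewrite cycle_id group1.
apply: connect_trans (to1 a) _.
by rewrite (sym_connect_sym (@enhanced_power_graph_sym gT)).
Qed.

(* Main.v *)
Require Import Defs.
From HB Require Import structures.
From mathcomp Require Import all_boot all_order all_algebra all_fingroup all_solvable.
From mathcomp Require Import ring zify.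

Set Implicit Arguments.
Unset Strict Implicit.
Unset Printing Implicit Defensive.

Import GRing.Theory Num.Theory.
Local Open Scope ring_scope.

(** Since every nontrivial element of the group has prime order [p] or [q], two
    distinct elements are at distance 1 if one of them is trivial or they generate
    the same subgroup, and at distance 2 otherwise.  Hence
    [x I - D = (x + 1) I - S C S^T], where [S] is the incidence matrix of elements
    and cyclic subgroups, and the Weinstein-Aronszajn identity ([det_blowup])
    reduces the determinant to one indexed by the cyclic subgroups: one trivial,
    one of order [q], and [q] of order [p].  The latter matrix depends only on
    these three types, apart from its diagonal, so the same identity reduces it
    further to a 3 x 3 determinant. *)

(* With [A = diag (e \o g)], [E = diag e] and [S] the incidence matrix of [g], one
   has [E S^T = S^T A]; both sides are obtained by eliminating in two ways a
   block of [block_mx A (S W) S^T 1]. *)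
Lemma det_blowup (R : comNzRingType) (n m : nat) (g : 'I_n -> 'I_m)
    (e : 'I_m -> R) (W : 'I_m -> 'I_m -> R) :
  \det (\matrix_(i, j) (e (g i) *+ (i == j) - W (g i) (g j)))
    * \prod_k e k =
  (\prod_i e (g i))
    * \det (\matrix_(k, l) (e k *+ (k == l) - #|[set i | g i == k]|%:R * W k l)).
Proof.
pose A : 'M[R]_n := diag_mx (\row_i e (g i)).
pose E : 'M[R]_m := diag_mx (\row_k e k).
pose S : 'M[R]_(n, m) := \matrix_(i, k) (g i == k)%:R.
pose V : 'M[R]_m := \matrix_(k, l) W k l.
have StA : E *m S^T = S^T *m A.
  apply/matrixP => k i; rewrite mul_diag_mx mul_mx_diag !mxE.
  by case: eqP => [->|]; rewrite ?mulr1 ?mul1r ?mulr0 ?mul0r.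
have SV i l : (S *m V) i l = W (g i) l.
  rewrite mxE (bigD1 (g i)) //= !mxE eqxx mul1r big1 ?addr0 // => k kg.
  by rewrite mxE eq_sym (negPf kg) mul0r.
have -> : \matrix_(i, j) (e (g i) *+ (i == j) - W (g i) (g j))
    = A - S *m V *m S^T.
  apply/matrixP => i j; rewrite !mxE; congr (_ - _).
  rewrite (bigD1 (g j)) //= SV !mxE eqxx mulr1 big1 ?addr0 // => k kg.
  by rewrite !mxE eq_sym (negPf kg) mulr0.
have -> : \matrix_(k, l) (e k *+ (k == l) - #|[set i | g i == k]|%:R * W k l)
    = E - S^T *m (S *m V).
  apply/matrixP => k l; rewrite !mxE; congr (_ - _).
  rewrite -sum1_card natr_sum mulr_suml [RHS](bigID (fun i => g i == k)) /=.
  rewrite [X in _ + X]big1 ?addr0 => [|i /negPf gi]; last by rewrite !mxE gi mul0r.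
  apply: eq_big => [i|i]; first by rewrite inE.
  by rewrite inE SV !mxE => /eqP ->; rewrite eqxx.
have -> : \prod_k e k = \det E.
  by rewrite det_diag; apply: eq_bigr => k _; rewrite mxE.
have -> : \prod_i e (g i) = \det A.
  by rewrite det_diag; apply: eq_bigr => k _; rewrite mxE.
pose X : 'M[R]_(n + m) := block_mx A (S *m V) S^T 1%:M.
have detX : \det X = \det (A - S *m V *m S^T).
  have := det_mulmx X (block_mx 1%:M 0 (- S^T) 1%:M).
  rewrite mulmx_block !mulmx1 !mulmx0 !add0r mul1mx mulmxN subrr.
  by rewrite det_ublock det_lblock !det1 !mulr1 => <-.
rewrite -detX mulrC.
(* Scaling the lower block row by [E] replaces an inversion of [A]; [StA] then makes the lower left
   block vanish. *)
have := det_mulmx (block_mx 1%:M 0 (- S^T) E) X.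
rewrite mulmx_block !mul1mx !mul0mx !addr0 !mulmx1 StA mulNmx addNr.
by rewrite det_ublock det_lblock det1 mul1r mulNmx addrC => ->.
Qed.

(** * Graph distances, and counting elements by the cyclic subgroup they generate *)

(** Distinct non-adjacent vertices both differ from [z], which is adjacent to all others, so the
    walk through [z] joins them in two steps. *)
Lemma gdist_dominated (T : finType) (e : rel T) (z : T) :
  symmetric e -> (forall u, u != z -> e u z) ->
  forall u v, gdist e u v = if u == v then 0%N else if e u v then 1%N else 2%N.
Proof.
move=> se dz u v.
have ez : connect e u v.
  have cz w : connect e w z.
    by have [-> //|wz] := eqVneq w z; apply/connect1/dz.
  by apply: connect_trans (cz u) _; rewrite (sym_connect_sym se).
have le k w : path e u w -> last u w = v -> size w = k -> (gdist e u v <= k)%N.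
  by move=> *; apply: gdist_le; apply/has_walkP; exists w.
have [w [pw lw sw]] := has_walkP _ _ _ _ (gdist_walk ez).
have [uv|uv] := eqVneq u v.
  by apply/eqP; rewrite -leqn0; apply: (le _ [::]).
case: ifP => euv.
  have : (gdist e u v <= 1)%N by apply: (le _ [:: v]); rewrite //= euv.
  case: w pw lw sw => [|x w _ _ <-] //=; first by move=> _ E; rewrite E eqxx in uv.
  by rewrite ltnS leqn0 => /eqP ->.
have uz : u != z.
  by apply: contraFneq euv => uz; rewrite uz in uv *; rewrite se dz // eq_sym.
have vz : v != z by apply: contraFneq euv => ->; rewrite dz.
have : (gdist e u v <= 2)%N.
  by apply: (le _ [:: z; v]); rewrite //= dz // se dz.
case: w pw lw sw => [|x [|y w]] /=; first by move=> _ E; rewrite E eqxx in uv.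
  by rewrite andbT => eux E; rewrite -E eux in euv.
by move=> _ _ <-; rewrite !ltnS leqn0 => /eqP ->.
Qed.

Lemma card_enum_val (T : finType) (A P : {pred T}) :
  #|[set k : 'I_#|A| | enum_val k \in P]| = #|[set x in A | x \in P]|.
Proof. by rewrite -!sum1dep_card big_enum_val_cond. Qed.

Definition cyclic_subgroups (gT : finGroupType) : {set {set gT}} :=
  [set <[x]>%g | x : gT].

Lemma cycle_in_cyclic_subgroups (gT : finGroupType) (x : gT) :
  <[x]>%g \in cyclic_subgroups gT.
Proof. exact: imset_f. Qed.

(** The fibre over [C] consists of the generators of [C]. *)
Lemma card_cycle_fibre (gT : finGroupType) (C : {set gT}) :
  C \in cyclic_subgroups gT -> #|[set x | <[x]>%g == C]| = totient #|C|.
Proof.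
case/imsetP => y _ ->; rewrite -orderE totient_gen.
by apply: eq_card => x; rewrite !inE /generator eq_sym.
Qed.

(** Each element generates exactly one cyclic subgroup. This counting equation later yields the
    number of subgroups of order [p]. *)
Lemma sum_totient_cyclic_subgroups (gT : finGroupType) :
  (\sum_(C in cyclic_subgroups gT) totient #|C|)%N = #|gT|.
Proof.
rewrite -sum1_card.
rewrite (partition_big (fun x => <[x]>%g) (fun C => C \in cyclic_subgroups gT)) /=.
  apply: eq_bigr => C cC; rewrite -(card_cycle_fibre cC) -sum1dep_card.
  by apply: eq_bigl.
by move=> x _; apply: cycle_in_cyclic_subgroups.
Qed.

Lemma cycle_eq_prime (gT : finGroupType) (a c : gT) :
  prime #[c]%g -> a \in <[c]>%g -> a != 1%g -> <[a]>%g = <[c]>%g.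
Proof.
move=> pc ac a1; apply/eqP; rewrite eqEcard cycle_subG ac -!orderE /=.
have := order_dvdG ac; rewrite -orderE => /(prime_nt_dvdP pc) -> //.
by rewrite order_eq1.
Qed.

(** A cyclic subgroup containing nontrivial [x] and [y] has prime order, so each of them generates
    it. *)
Lemma adjacent_prime_orders (gT : finGroupType) :
  (forall x : gT, x != 1%g -> prime #[x]%g) ->
  forall x y : gT, enhanced_power_graph x y =
    (x != y) && [|| x == 1, y == 1 | <[x]> == <[y]>]%g.
Proof.
move=> pr x y; rewrite /enhanced_power_graph; congr (_ && _).
have [->|x1] := eqVneq x 1%g.
  by apply/existsP; exists y; rewrite group1 cycle_id.
have [->|y1] := eqVneq y 1%g.
  by apply/existsP; exists x; rewrite group1 cycle_id.
apply/existsP/eqP => [[c /andP[xc yc]]|E]; last first.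
  by exists x; rewrite {2}E !cycle_id.
have pc : prime #[c]%g.
  by apply: pr; apply: contraNneq x1 => c1; move: xc; rewrite c1 cycle1 inE.
by rewrite (cycle_eq_prime pc xc) // (cycle_eq_prime pc yc).
Qed.

(** * Cyclic subgroups and distances in the non-abelian group of order [p * q] *)

Section NonabelianPQ.

Variables (p q : nat) (gT : finGroupType).
Hypotheses (hp : prime p) (hq : prime q) (hpq : (p < q)%N).
Hypotheses (hcard : #|[set: gT]| = (p * q)%N) (hnab : ~~ abelian [set: gT]).

Let cyc := cyclic_subgroups gT.

(** If [p] does not divide the order, the order divides [q]. Otherwise it is [p] or [p * q], and the
    latter would make the group cyclic, hence abelian. *)
Lemma order_pq (x : gT) : x != 1%g -> #[x]%g = p \/ #[x]%g = q.
Proof.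
move=> x1; have dx : (#[x]%g %| p * q)%N by rewrite -hcard order_dvdG ?inE.
have nx : #[x]%g != 1%N by rewrite order_eq1.
have [/dvdnP[d Ed]|npx] := boolP (p %| #[x]%g)%N; last first.
  right; apply/(prime_nt_dvdP hq nx).
  by move: dx; rewrite Gauss_dvdr // coprime_sym prime_coprime.
left; move: dx; rewrite Ed mulnC dvdn_pmul2l ?prime_gt0 //.
have [-> //|d1 /(prime_nt_dvdP hq d1) dq] := eqVneq d 1%N; first by rewrite muln1.
case/negP: hnab; suff <- : <[x]>%g = [set: gT] by exact: cycle_abelian.
by apply/eqP; rewrite eqEcard subsetT hcard -orderE Ed dq mulnC leqnn.
Qed.

Lemma prime_order_pq (x : gT) : x != 1%g -> prime #[x]%g.
Proof. by case/order_pq => ->. Qed.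

(** Two distinct subgroups of prime order [q] meet trivially, so their product would have
    [q * q > p * q] elements. *)
Lemma cycle_q_unique (x y : gT) :
  #[x]%g = q -> #[y]%g = q -> <[x]>%g = <[y]>%g.
Proof.
move=> ox oy; apply/eqP; rewrite eqEcard -!orderE ox oy leqnn andbT.
apply/negPn/negP => nxy; have := mul_cardG <[x]> <[y]>.
rewrite prime_TIg -?orderE ?ox // oy cards1 muln1 => E.
have := max_card (mem (<[x]> * <[y]>)%g).
by rewrite -E -cardsT hcard leq_pmul2r ?prime_gt0 // leqNgt hpq.
Qed.

Lemma card_cyclic_subgroups_1 : #|[set C in cyc | #|C| == 1%N]| = 1%N.
Proof.
apply/eqP/cards1P; exists 1%g; apply/setP => C; rewrite !inE.
apply/andP/eqP => [[/imsetP[x _ ->]]|->].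
  by rewrite -orderE order_eq1 => /eqP ->; rewrite cycle1.
by rewrite cards1 -cycle1 cycle_in_cyclic_subgroups.
Qed.

Lemma card_cyclic_subgroups_q : #|[set C in cyc | #|C| == q]| = 1%N.
Proof.
have dq : (q %| #|[set: gT]|)%N by rewrite hcard dvdn_mull.
have [y _ oy] := Cauchy hq dq.
apply/eqP/cards1P; exists <[y]>%g; apply/setP => C; rewrite !inE.
apply/andP/eqP => [[/imsetP[x _ ->]]|->].
  by rewrite -orderE => /eqP ox; apply: cycle_q_unique.
by rewrite -orderE oy cycle_in_cyclic_subgroups.
Qed.

(** With [N] subgroups of order [p], counting generators gives [p * q = 1 + (q - 1) + N * (p - 1)],
    hence [N * (p - 1) = q * (p - 1)]. *)
Lemma card_cyclic_subgroups_p : #|[set C in cyc | #|C| == p]| = q.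
Proof.
have q1 : (1 < q)%N by apply: prime_gt1.
have p1 : (1 < p)%N by apply: prime_gt1.
have := sum_totient_cyclic_subgroups gT; rewrite -cardsT hcard.
have part (n : nat) : (\sum_(C in cyc | #|C| == n) totient #|C|)%N
    = (#|[set C in cyc | #|C| == n]| * totient n)%N.
  rewrite -sum1dep_card big_distrl /=.
  by apply: eq_bigr => C /andP[_ /eqP ->]; rewrite mul1n.
rewrite (bigID (fun C : {set gT} => #|C| == 1%N)) /= part card_cyclic_subgroups_1.
rewrite (bigID (fun C : {set gT} => #|C| == q)) /=.
rewrite (eq_bigl (fun C => (C \in cyc) && (#|C| == q))) ?part => [|C]; last first.
  by case: (C \in _) => //=; case: eqP => [->|]; rewrite ?andbF ?andbT; lia.
rewrite card_cyclic_subgroups_q.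
rewrite (eq_bigl (fun C => (C \in cyc) && (#|C| == p))) ?part => [|C]; last first.
  case cC : (C \in _) => //=; case/imsetP: cC => x _ ->; rewrite -orderE.
  have [->|/order_pq[]->] := eqVneq x 1%g; first by rewrite order1; lia.
    by rewrite eqxx; lia.
  by rewrite eqxx andbF; lia.
rewrite (totient_prime hp) (totient_prime hq) (_ : totient 1 = 1%N) // => E.
apply/eqP; rewrite -(eqn_pmul2r (m := p.-1)); last by lia.
have -> : (q * p.-1)%N = (p * q - q)%N by rewrite -subn1 mulnBr muln1 mulnC.
by apply/eqP; rewrite -E; move: (_ * p.-1)%N => X; lia.
Qed.

(** The last type is a catch-all which, among the cyclic subgroups of this group, means order
    [p]. *)
Definition cell_type (C : {set gT}) : 'I_3 :=
  inord (if #|C| == 1 then 0 else if #|C| == q then 1 else 2)%N.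

Lemma cell_typeE (C : {set gT}) : cell_type C =
  (if #|C| == 1 then 0 else if #|C| == q then 1 else 2)%N :> nat.
Proof. by rewrite inordK //; case: ifP => // _; case: ifP. Qed.

(** The value 1 at [C == C'] is the distance between distinct generators of one subgroup; the zero
    diagonal of the distance matrix is restored by subtracting the identity matrix. *)
Definition cell_dist (C C' : {set gT}) : nat :=
  if [|| #|C| == 1%N, #|C'| == 1%N | C == C'] then 1%N else 2%N.

Lemma gdist_pq (x y : gT) :
  gdist (@enhanced_power_graph gT) x y = (cell_dist <[x]>%g <[y]>%g - (x == y))%N.
Proof.
have adj := adjacent_prime_orders prime_order_pq.
rewrite (gdist_dominated (z := 1%g)) => [|u v|u u1]; last first.
- by rewrite adj u1 eqxx orbT.
- exact: enhanced_power_graph_sym.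
rewrite /cell_dist -!orderE !order_eq1 adj.
by have [->|] := eqVneq x y; rewrite ?eqxx ?orbT ?subn0.
Qed.

Lemma cyc_card (C : {set gT}) : C \in cyc -> [\/ #|C| = 1%N, #|C| = p | #|C| = q].
Proof.
case/imsetP => x _ ->; rewrite -orderE.
have [->|/order_pq[]->] := eqVneq x 1%g.
- by rewrite order1; constructor 1.
- by constructor 2.
- by constructor 3.
Qed.

Lemma card_cell_type (s : 'I_3) :
  #|[set C in cyc | cell_type C == s]| = nth 0%N [:: 1; 1; q]%N s.
Proof.
have q1 : (1 < q)%N by apply: prime_gt1.
have p1 : (1 < p)%N by apply: prime_gt1.
have -> : [set C in cyc | cell_type C == s]
    = [set C in cyc | #|C| == nth 0%N [:: 1; q; p]%N s].
  apply/setP => C; rewrite !inE; case cC : (C \in cyc) => //=.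
  rewrite -val_eqE /= cell_typeE.
  by case: s => -[|[|[|//]]] i /=; case: (cyc_card cC) => ->;
    rewrite ?eqxx; repeat case: eqP; lia.
case: s => -[|[|[|//]]] i /=.
- exact: card_cyclic_subgroups_1.
- exact: card_cyclic_subgroups_q.
- exact: card_cyclic_subgroups_p.
Qed.

End NonabelianPQ.

(** * Evaluation of the characteristic polynomial *)

(** Natural-number indices give the lifted ordinals of the cofactor expansion a normal form on which
    [ring] can work. *)
Lemma det_mx33 (R : comNzRingType) (M : 'I_3 -> 'I_3 -> R) :
  let a i j := M (inord i) (inord j) in
  \det (\matrix_(i, j) M i j) =
    a 0%N 0%N * (a 1%N 1%N * a 2%N 2%N - a 1%N 2%N * a 2%N 1%N)
    - a 0%N 1%N * (a 1%N 0%N * a 2%N 2%N - a 1%N 2%N * a 2%N 0%N)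
    + a 0%N 2%N * (a 1%N 0%N * a 2%N 1%N - a 1%N 1%N * a 2%N 0%N).
Proof.
move=> a; have Ea i j : M i j = a i j by rewrite /a !inord_val.
do 2![rewrite ?(expand_det_row _ ord0) !big_ord_recl !big_ord0 /cofactor].
rewrite !det_mx11 !mxE !Ea /= /bump /=; ring.
Qed.

Theorem theorem3p1 (p q : nat) (gT : finGroupType)
    (hp : prime p) (hq : prime q) (hpq : (p < q)%N)
    (hcard : #|[set: gT]| = (p * q)%N) (hnab : ~~ abelian [set: gT]) :
  distance_char_poly (@enhanced_power_graph gT) =
    ('X + 1) ^+ (p * q - q - 2) * ('X + p%:R) ^+ (q - 1)
    * ('X^3
       + 'X^2 * (- 2 * p%:R * q%:R + p%:R + q%:R + 2)
       + 'X * (- 2 * p%:R * q%:R ^+ 2 - 2 * p%:R * q%:R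
               + 2 * q%:R ^+ 2 + 2 * p%:R + 1)
       - (p%:R * q%:R ^+ 2 + p%:R * q%:R - p%:R - q%:R ^+ 2)).
Proof.
have q1 : (1 < q)%N by apply: prime_gt1.
have p1 : (1 < p)%N by apply: prime_gt1.
set cyc := cyclic_subgroups gT.
have inc (x : gT) : <[x]>%g \in cyc by apply: cycle_in_cyclic_subgroups.
(* [inc 1%g] only witnesses that [cyc] is nonempty; the default index for sets outside [cyc] is
   never reached. *)
pose cell (i : 'I_#|gT|) : 'I_#|cyc| := enum_rank_in (inc 1%g) <[enum_val i]>%g.
have cellK i : enum_val (cell i) = <[enum_val i]>%g by rewrite enum_rankK_in.
pose type (k : 'I_#|cyc|) : 'I_3 := cell_type q (enum_val k).
(* [e 2] is ['X + 1] plus [p - 1], which corrects [w 2 2 = 2] on the diagonal, where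
   [cell_dist] is 1. *)
pose e (s : 'I_3) : {poly int} := if s == 2%N :> nat then 'X + p%:R else 'X + 1.
(* There is a single subgroup of order [q], so [w 1 1] is met only on the diagonal, where
   [cell_dist] is 1. *)
pose w (s r : 'I_3) : nat := if (s == 0%N :> nat) || (r == 0%N :> nat) then 1%N
  else if (s == 1%N :> nat) && (r == 1%N :> nat) then 1%N else 2%N.
pose n (s : 'I_3) : nat := nth 0%N [:: 1; q.-1; p.-1]%N s.
have cellN k : #|[set i | cell i == k]| = n (type k).
  have -> : [set i | cell i == k]
      = [set i | enum_val i \in [pred x : gT | <[x]>%g == enum_val k]].
    by apply/setP => i; rewrite !inE -cellK (inj_eq enum_val_inj).
  rewrite card_enum_val.
  have := card_cycle_fibre (enum_valP k).
  rewrite [X in _ = X -> _](_ : _ = n (type k)) => [<-|].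
    by apply: eq_card => x; rewrite !inE.
  rewrite /n cell_typeE.
  have [->|->|->] := cyc_card hp hq hcard hnab (enum_valP k).
  - by rewrite eqxx.
  - by rewrite (totient_prime hp) (gtn_eqF p1) (ltn_eqF hpq).
  - by rewrite (totient_prime hq) eqxx (gtn_eqF q1).
have typeN s : #|[set k | type k == s]| = nth 0%N [:: 1; 1; q]%N s.
  rewrite -(card_cell_type hp hq hpq hcard hnab).
  have := card_enum_val cyc [pred C | cell_type q C == s].
  by move=> E; rewrite -[RHS]E; apply: eq_card => k; rewrite !inE.
have prodtype (F : 'I_3 -> {poly int}) :
    \prod_k F (type k) = \prod_s F s ^+ nth 0%N [:: 1; 1; q]%N s.
  rewrite (partition_big type predT) //=; apply: eq_bigr => s _.
  by rewrite -typeN -prodr_const; apply: eq_big => [k|k /eqP ->]; rewrite ?inE.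
have cycN : #|cyc| = (q + 2)%N.
  have := sum1_card 'I_#|cyc|; rewrite card_ord => <-.
  rewrite (partition_big type predT) //=.
  rewrite !big_ord_recl big_ord0 !sum1dep_card !typeN /=; lia.
have char_D : distance_char_poly (@enhanced_power_graph gT) =
    \det (\matrix_(i, j) (('X + 1) *+ (i == j)
      - (cell_dist (enum_val (cell i)) (enum_val (cell j)))%:R)) :> {poly int}.
  congr (\det _); apply/matrixP => i j; rewrite !mxE !cellK.
  rewrite (gdist_pq hp hq hcard hnab) (inj_eq enum_val_inj).
  have [->|_] := eqVneq i j; last by rewrite subn0 -natz polyC_natr.
  rewrite /cell_dist eqxx !orbT /= subnn polyC0; ring.
(* First reduction, from elements to cyclic subgroups: it sets [('X + 1) ^+ (q + 2)] against
   [('X + 1) ^+ (p * q)]. *)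
have := det_blowup cell (fun=> 'X + 1 : {poly int})
  (fun k l => (cell_dist (enum_val k) (enum_val l))%:R).
rewrite -char_D !prodr_const !card_ord.
have -> : \matrix_(k, l) (('X + 1) *+ (k == l) - #|[set i | cell i == k]|%:R
      * (cell_dist (enum_val k) (enum_val l))%:R) =
    \matrix_(k, l) (e (type k) *+ (k == l)
      - (n (type k))%:R * (w (type k) (type l))%:R) :> 'M[{poly int}]_#|cyc|.
  apply/matrixP => k l; rewrite !mxE cellN.
  have typek := cell_typeE q (enum_val k); have typel := cell_typeE q (enum_val l).
  rewrite -/(type k) -/(type l) in typek typel.
  have [<-|kl] := eqVneq k l.
    rewrite /cell_dist eqxx !orbT /= /n /e /w !typek.
    have [_|_] := eqVneq _ 1%N; first by [].
    have [_|_] := eqVneq _ q; first by [].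
    by rewrite /= (_ : p.-1%:R = p%:R - 1); [ring | rewrite -subn1 natrB // ltnW].
  congr (_ - _ * _%:R); rewrite /cell_dist (inj_eq enum_val_inj) (negPf kl) orbF.
  rewrite /w typek typel.
  have [_|_] := eqVneq _ 1%N; first by [].
  have [_|_] := eqVneq #|enum_val l| 1%N; first by rewrite /= orbT.
  have [Ck|_] := eqVneq _ q; have [Cl|_] := eqVneq #|enum_val l| q => //.
  (* The remaining case, two distinct subgroups of order [q], contradicts uniqueness. *)
  case/eqP: kl; apply: enum_val_inj.
  have /imsetP[x _ Ex] := enum_valP k; have /imsetP[y _ Ey] := enum_valP l.
  by rewrite Ex Ey; apply: (cycle_q_unique hq hpq hcard); rewrite orderE -?Ex -?Ey.
have nz m : ('X + m%:R : {poly int}) != 0.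
  by rewrite -polyC_natr -[_%:P]opprK -polyCN polyXsubC_eq0.
set d2 := \det _; rewrite cycN -cardsT hcard => H1.
(* Second reduction, from cyclic subgroups to their three types; [prodtype] gives the factor
   [('X + 1) ^+ 2 * ('X + p%:R) ^+ q]. *)
have := det_blowup type e (fun s r => (n s)%:R * (w s r)%:R).
rewrite -/d2 prodtype det_mx33 /= !typeN /n /w /e -!val_eqE /=.
rewrite !big_ord_recl !big_ord0 !inordK //=.
rewrite (_ : p.-1%:R = p%:R - 1); last by rewrite -subn1 natrB // ltnW.
rewrite (_ : q.-1%:R = q%:R - 1); last by rewrite -subn1 natrB // ltnW.
set cubic := (X in _ = _ * X -> _) => H2.
set goal_cubic := (X in _ = _ * X).
have cubicE : cubic = goal_cubic by rewrite /cubic /goal_cubic; ring.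
have d2E : d2 = ('X + p%:R) ^+ (q - 1) * goal_cubic.
  have nz3 := mulf_neq0 (mulf_neq0 (nz 1%N) (nz 1%N)) (nz p).
  (* Cancelling the product of [e] over the three types removes both factors ['X + 1] and one factor
     ['X + p%:R], whence the exponent [q - 1]. *)
  apply: (mulIf nz3); transitivity (d2 * (('X + 1) * (('X + 1) * (('X + p%:R) * 1)))).
    by ring.
  have -> := H2; rewrite cubicE.
  have -> : ('X + p%:R : {poly int}) ^+ q = ('X + p%:R) ^+ (q - 1) * ('X + p%:R).
    by rewrite -exprSr subn1 prednK // ltnW.
  by ring.
apply: (mulIf (expf_neq0 (q + 2) (nz 1%N))).
(* As [2 <= p < q], one has [q + 2 <= p * q], so the truncated subtractions in the exponent are
   exact. *)
have powE : ('X + 1 : {poly int}) ^+ (p * q)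
    = ('X + 1) ^+ (p * q - q - 2) * ('X + 1) ^+ (q + 2).
  by rewrite -exprD; congr (_ ^+ _); nia.
by rewrite [LHS]H1 d2E powE; ring.
Qed.
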